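(* Let $k\geq 3$ and $r\geq 0$ be integers, let $n=(2r-1)(k-2)+r-1$ and $$Q(k,r)=\frac{1}{4}\left[(2k-1)^2+\sqrt{(2k-1)^4+16k(kn+1)}\right]^2.$$ Then there exists a simple $(\frac{q-1}{2},k;r)$ Heffter space for every prime power $q\equiv 2k+1 \pmod{4k}$ with $q>Q(k,r)$.
   Context: A $(v_r,b_k)$ configuration is a point-block incidence structure $(V,\mathcal{B})$ with $v$ points and $b$ blocks, each block a $k$-subset of $V$, any two distinct points in at most one common block, and every point in exactly $r$ blocks; it is resolvable if $\mathcal{B}$ partitions into $r$ parallel classes, each of which is a partition of $V$. A half-set of an abelian group $G$ is a subset $V$ with $V$ and $-V$ partitioning $G\setminus\{0\}$. A $(v,k;r)$ Heffter space over an abelian group $G$ is a resolvable $(v_r,b_k)$ configuration whose point set is a half-set of $G$ and whose blocks are all zero-sum in $G$. It is simple if every block can be ordered so that its partial sums are pairwise distinct. *)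

(* Defs.v *)
From HB Require Import structures.
From mathcomp Require Import all_boot all_order all_algebra.
From mathcomp Require Import reals.

Set Implicit Arguments.
Unset Strict Implicit.
Unset Printing Implicit Defensive.

Import Order.TTheory GRing.Theory Num.Theory.

Local Open Scope ring_scope.

Definition prime_power (q : nat) : Prop :=
  exists p m : nat, [/\ prime p, (0 < m)%N & q = (p ^ m)%N].

Definition configuration (T : finType) (V : {set T}) (B : {set {set T}})
    (v r b k : nat) : Prop :=
  [/\ #|V| = v,
      #|B| = b,
      {in B, forall A : {set T}, A \subset V /\ #|A| = k},
      {in V &, forall x y : T, x != y ->
         (#|[set A in B | (x \in A) && (y \in A)]| <= 1)%N}
    & {in V, forall x : T, #|[set A in B | x \in A]| = r}].

(* The members of P are the parallel classes. *)
Definition resolvable (T : finType) (V : {set T}) (B : {set {set T}})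
    (r : nat) : Prop :=
  exists P : {set {set {set T}}},
    [/\ partition P B,
        #|P| = r
      & {in P, forall C : {set {set T}}, partition C V}].

Definition half_set (G : finZmodType) (V : {set G}) : Prop :=
  [disjoint V & [set - x | x in V]] /\
  V :|: [set - x | x in V] = [set~ 0].

Definition zero_sum (G : finZmodType) (A : {set G}) : Prop :=
  \sum_(x in A) x = 0.

Definition heffter_space (G : finZmodType) (V : {set G}) (B : {set {set G}})
    (v k r : nat) : Prop :=
  [/\ exists b : nat, configuration V B v r b k,
      resolvable V B r,
      half_set V
    & {in B, forall A : {set G}, zero_sum A}].

(* For s = [:: x1; ...; xk] this is [:: x1; x1 + x2; ...; x1 + ... + xk]: the
   empty sum is not included, so a zero-sum block can have distinct partial
   sums. *)
Definition partial_sums (G : finZmodType) (s : seq G) : seq G :=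
  scanl +%R 0 s.

Definition simple_blocks (G : finZmodType) (B : {set {set G}}) : Prop :=
  {in B, forall A : {set G},
     exists s : seq G, perm_eq s (enum A) /\ uniq (partial_sums s)}.

(* An integer, not a natural number: it is negative for r = 0. *)
Definition heffter_n (k r : nat) : int :=
  (2 * r%:Z - 1) * (k%:Z - 2) + r%:Z - 1.

Definition heffter_Q (R : realType) (k r : nat) : R :=
  4^-1 * ((2 * k%:R - 1) ^+ 2
          + Num.sqrt ((2 * k%:R - 1) ^+ 4
                      + 16 * k%:R * (k%:R * (heffter_n k r)%:~R + 1))) ^+ 2.

(* Main.v *)
Require Import Defs.
From HB Require Import structures.
From mathcomp Require Import all_boot all_order all_algebra.
From mathcomp Require Import cyclic finfield.
From mathcomp Require Import ring lra zify.
From mathcomp Require Import reals.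

Set Implicit Arguments.
Unset Strict Implicit.
Unset Printing Implicit Defensive.

Import Order.TTheory GRing.Theory Num.Theory.

Local Open Scope ring_scope.

(** Write [q = 2 k t + 1] with [t] odd, let [F] be the field with [q] elements,
    [C] its group of [t]-th roots of unity and [C_i] the cosets of [C], indexed
    modulo [2 k].  As [t] is odd, [-1] lies in [C_k], so that
    [V = C_0 u ... u C_(k-1)] is a half-set.  If [B] is a zero-sum transversal of
    [C_0, ..., C_(k-1)], the blocks [B c] with [c] in [C] form a parallel class on
    [V], and [r] such base blocks give a configuration as soon as the ratios
    [b_j / b_i] differ from one base block to another.

    Base blocks are built greedily.  The elements [b_0, ..., b_(k-3)] only have to
    avoid few values; with [s] their sum, [x = b_(k-2)] must lie in [C_(k-2)] with
    [x + s] in [- C_(k-1)], and must avoid at most [n = (2r-1)(k-2) + r-1] values.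
    So it suffices that the number [N] of [x] with [x] and [x + s] in prescribed
    cosets exceeds [n], and [q > Q(k, r)] is what this takes, given the Weil type
    bound [e^2 N >= q - (e-1)^2 sqrt q - 2 e] for [e = 2 k].

    That bound needs no character sums.  Let [(A_g f)(x) = sum_(c in C) f(x + g c)].
    On functions of sum zero, [sum_g A_g = - t] and
    [sum_g |A_g f|^2 = t (q - t) |f|^2], the sums being over [g != 0].  Since
    [A_g] only depends on the coset of [g], comparing one coset with the mean of
    the others bounds the norm of [A_g + 1/e] by [(e-1) sqrt q / e].  Finally [t N]
    is the inner product of a coset indicator with [A_s] of another one. *)

(** * Coset sums and the cyclotomic count *)

Section CosetSums.

Variables (R : rcfType) (F : finFieldType) (C : {set F}) (e t : nat).
Hypothesis C1 : 1 \in C.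
Hypothesis CM : forall x y, x \in C -> y \in C -> x * y \in C.
Hypothesis CV : forall x, x \in C -> x^-1 \in C.
Hypothesis C0 : 0 \notin C.
Hypothesis cardC : #|C| = t.
Hypothesis cardF : #|F| = (e * t).+1.
Hypothesis e_gt1 : (1 < e)%N.

Implicit Types (f : F -> R) (g h x a b : F).

Let C_neq0 c : c \in C -> c != 0.
Proof. by apply: contraTneq => ->. Qed.

Let t_gt0 : (0 < t)%N.
Proof. by rewrite -cardC; apply/card_gt0P; exists 1. Qed.

Let memCMl c x : c \in C -> (x * c \in C) = (x \in C).
Proof.
move=> cC; apply/idP/idP => [xcC|xC]; last exact: CM.
by rewrite -(mulfK (C_neq0 cC) x) CM // CV.
Qed.

Definition coset_sum f g x : R := \sum_(c in C) f (x + g * c).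

Lemma sum_shift f y : \sum_x f (x + y) = \sum_x f x.
Proof. by rewrite [RHS](reindex_inj (addIr y)). Qed.

Lemma sum_line_punctured f x y : y != 0 ->
  \sum_(g | g != 0) f (x + g * y) = \sum_z f z - f x.
Proof.
move=> y0; have inj : injective (fun g => x + g * y).
  by move=> g h /addrI /(mulIf y0).
by rewrite [\sum_z _](reindex_inj inj) [in RHS](bigD1 0) //= mul0r addr0 [RHS]addrC addKr.
Qed.

Lemma card_nonzero : #|[pred g : F | g != 0]| = (e * t)%N.
Proof.
have := cardC1 (0 : F); rewrite cardF /= => <-.
by apply: eq_card => g; rewrite !inE.
Qed.

Lemma sum_const_nonzero (c : R) :
  \sum_(g : F | g != 0) c = e%:R * t%:R * c.
Proof. by rewrite sumr_const card_nonzero -natrM mulr_natl. Qed.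

Lemma card_coset h : h != 0 -> #|[pred g | g / h \in C]| = t.
Proof.
move=> h0; rewrite -cardC -(card_imset _ (mulIf h0)).
apply: eq_card => g; rewrite inE; apply/idP/imsetP => [ghC|[c cC ->]].
  by exists (g / h); rewrite ?divfK.
by rewrite mulfK.
Qed.

(** Multiplication by [g / h] permutes [C]. *)
Lemma coset_sum_coset f g h x : h != 0 -> g / h \in C ->
  coset_sum f g x = coset_sum f h x.
Proof.
move=> h0 ghC; have gh0 := C_neq0 ghC.
rewrite /coset_sum [RHS](reindex_inj (mulfI gh0)) /=.
apply: eq_big => c; first by rewrite mulrC memCMl.
by move=> _; rewrite mulrA [h * _]mulrC divfK.
Qed.

Lemma sum_coset_sum f x : \sum_z f z = 0 ->
  \sum_(g | g != 0) coset_sum f g x = - (t%:R * f x).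
Proof.
move=> f0; rewrite exchange_big /=.
under eq_bigr => c cC do rewrite sum_line_punctured ?C_neq0 // f0 sub0r.
by rewrite sumr_const cardC mulNrn mulr_natl.
Qed.

(** A translation turns the product into [f x * f (x + g * (d - c))]. If [d != c], the second
    argument runs over every element except [x], where [f] has sum [- f x]; otherwise there are
    [e * t] equal terms. *)
Lemma autocorrelation f (c d : F) : \sum_z f z = 0 ->
  \sum_(g | g != 0) \sum_x f (x + g * c) * f (x + g * d) =
  (if d == c then (e * t)%:R else -1) * \sum_x f x ^+ 2.
Proof.
move=> f0.
have shift g : \sum_x f (x + g * c) * f (x + g * d) =
               \sum_x f x * f (x + g * (d - c)).
  rewrite -(sum_shift (fun x => f x * f (x + g * (d - c))) (g * c)).
  by apply: eq_bigr => x _; congr (_ * f _); ring.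
under eq_bigr => g _ do rewrite shift.
case: eqVneq => [->|dc].
  under eq_bigr => g _ do under eq_bigr => x _
    do rewrite subrr mulr0 addr0 -expr2.
  by rewrite sumr_const card_nonzero mulr_natl.
rewrite exchange_big mulr_sumr; apply: eq_bigr => x _.
by rewrite -mulr_sumr sum_line_punctured ?subr_eq0 // f0; ring.
Qed.

(** Expand the square over pairs [(c, d)]: the [t] diagonal pairs have weight [e * t], the
    [t * (t - 1)] others weight [-1]. *)
Lemma sum_coset_sum_sqr f : \sum_z f z = 0 ->
  \sum_x \sum_(g | g != 0) coset_sum f g x ^+ 2 =
  t%:R * ((e * t)%:R + 1 - t%:R) * \sum_x f x ^+ 2.
Proof.
move=> f0.
have -> : \sum_x \sum_(g | g != 0) coset_sum f g x ^+ 2 =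
  \sum_(c in C) \sum_(d in C)
    \sum_(g | g != 0) \sum_x f (x + g * c) * f (x + g * d).
  rewrite exchange_big /=.
  under [RHS]eq_bigr => c _ do rewrite exchange_big /=.
  rewrite [RHS]exchange_big /=; apply: eq_bigr => g _.
  under [RHS]eq_bigr => c _ do rewrite exchange_big /=.
  rewrite [RHS]exchange_big /=; apply: eq_bigr => x _.
  rewrite expr2 mulr_suml; apply: eq_bigr => c _.
  by rewrite mulr_sumr.
set S := \sum_x f x ^+ 2.
under eq_bigr => c cC.
  under eq_bigr => d _ do rewrite autocorrelation //.
  rewrite -mulr_suml (bigD1 c) //= eqxx.
  under eq_bigr => d /andP[_ /negPf dc] do rewrite dc.
  rewrite sumr_const.
  have -> : #|[pred d in C | d != c]| = t.-1.
    by have := cardD1 c C; rewrite cC cardC add1n => ->; apply: eq_card => d; rewrite !inE andbC.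
over.
rewrite sumr_const cardC -[LHS]mulr_natl mulrA; congr (_ * _ * _).
rewrite mulNrn; have -> : t%:R = t.-1%:R + 1 :> R by rewrite natr1 prednK.
by ring.
Qed.

(** Adding [f x / e] centres the [e * t] values [coset_sum f g x], whose sum is [- t * f x]. The
    total of their squares is known exactly, and a single coset can carry only a limited share of
    it. *)
Lemma coset_sum_norm f h : h != 0 -> \sum_z f z = 0 ->
  e%:R ^+ 2 * \sum_x (coset_sum f h x + f x / e%:R) ^+ 2 <=
  (e%:R - 1) ^+ 2 * ((e * t)%:R + 1) * \sum_x f x ^+ 2.
Proof.
move=> h0 f0.
have E1 : 1 < e%:R :> R by rewrite (ltr_nat _ 1 e).
have E0 : 0 < e%:R :> R by apply: lt_trans E1.
have T0 : 0 < t%:R :> R by rewrite ltr0n.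
pose a g x := coset_sum f g x + f x / e%:R.
have sum_a x : \sum_(g | g != 0) a g x = 0.
  rewrite big_split /= sum_coset_sum // sum_const_nonzero.
  by field; rewrite gt_eqF.
have sum_a2 : \sum_x \sum_(g | g != 0) a g x ^+ 2 =
    t%:R * ((e * t)%:R + 1) * (e%:R - 1) / e%:R * \sum_x f x ^+ 2.
  transitivity (\sum_x (\sum_(g | g != 0) coset_sum f g x ^+ 2
                 - t%:R / e%:R * f x ^+ 2)).
    apply: eq_bigr => x _.
    transitivity (\sum_(g | g != 0) (coset_sum f g x ^+ 2 +
        2 * f x / e%:R * coset_sum f g x + (f x / e%:R) ^+ 2)).
      by apply: eq_bigr => g _; rewrite /a; ring.
    rewrite !big_split /= -mulr_sumr sum_coset_sum // sum_const_nonzero.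
    by field; rewrite gt_eqF.
  rewrite sumrB sum_coset_sum_sqr // -mulr_sumr natrM.
  by field; rewrite gt_eqF.
(* Among the [e t] values [a g x], which sum to [0], the value [a h x] is taken
   [t] times; compare the others with their common mean [- a h x / (e - 1)]. *)
have pointwise x : e%:R * t%:R * a h x ^+ 2 <=
                   (e%:R - 1) * \sum_(g | g != 0) a g x ^+ 2.
  have memh g : g / h \in C -> g != 0.
    by move/C_neq0; apply: contraNneq => ->; rewrite mul0r.
  have split (G : F -> R) : \sum_(g | g != 0) G g =
      \sum_(g | g / h \in C) G g + \sum_(g | (g != 0) && (g / h \notin C)) G g.
    rewrite (bigID (fun g => g / h \in C)) /=; congr (_ + _).
    by apply: eq_bigl => g; case ghC: (_ \in C); rewrite ?andbF // memh.
  have on_h (G : R -> R) : \sum_(g | g / h \in C) G (a g x) = t%:R * G (a h x).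
    rewrite (eq_bigr (fun=> G (a h x))).
      by rewrite sumr_const card_coset // mulr_natl.
    by move=> g ghC; rewrite /a (coset_sum_coset _ _ h0 ghC).
  have card_off : \sum_(g | (g != 0) && (g / h \notin C)) 1 =
      (e%:R - 1) * t%:R :> R.
    have := split (fun=> 1); rewrite sum_const_nonzero (on_h (fun=> 1)).
    by lra.
  have sum_off := split (a^~ x); rewrite sum_a (on_h id) in sum_off.
  have sum2_off := split (fun g => a g x ^+ 2).
  rewrite (on_h (fun z => z ^+ 2)) in sum2_off.
  set P := (fun g => (g != 0) && (g / h \notin C)) in card_off sum_off sum2_off.
  (* Each term is the squared deviation from that mean, scaled by [(e - 1) ^ 2]; the whole sum is
     [e - 1] times the difference of the two sides. *)
  have : 0 <= \sum_(g | P g) ((e%:R - 1) * a g x + a h x) ^+ 2.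
    by apply: sumr_ge0 => g _; apply: sqr_ge0.
  have -> : \sum_(g | P g) ((e%:R - 1) * a g x + a h x) ^+ 2 =
     \sum_(g | P g) ((e%:R - 1) ^+ 2 * a g x ^+ 2 +
        2 * (e%:R - 1) * a h x * a g x + a h x ^+ 2 * 1).
    by apply: eq_bigr => g _; ring.
  rewrite !big_split /= -!mulr_sumr card_off.
  have -> : \sum_(g | P g) a g x = - (t%:R * a h x) by lra.
  have -> : \sum_(g | P g) a g x ^+ 2 =
     \sum_(g | g != 0) a g x ^+ 2 - t%:R * a h x ^+ 2 by lra.
  set S := \sum_(g | g != 0) _ => ge0.
  have : 0 <= (e%:R - 1) * ((e%:R - 1) * S - e%:R * t%:R * a h x ^+ 2).
    by apply: le_trans ge0 _; rewrite le_eqVlt; apply/orP; left; apply/eqP; ring.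
  by rewrite pmulr_rge0 ?subr_gt0 // subr_ge0.
have le_sum : e%:R * t%:R * \sum_x a h x ^+ 2 <=
    (e%:R - 1) * \sum_x \sum_(g | g != 0) a g x ^+ 2.
  by rewrite !mulr_sumr; apply: ler_sum => x _; apply: pointwise.
rewrite -/(a h) -(ler_pM2l T0).
have -> : t%:R * (e%:R ^+ 2 * \sum_x a h x ^+ 2) =
   e%:R * (e%:R * t%:R * \sum_x a h x ^+ 2) by ring.
apply: le_trans (ler_wpM2l (ltW E0) le_sum) _; rewrite sum_a2.
rewrite le_eqVlt; apply/orP; left; apply/eqP.
by field; rewrite gt_eqF.
Qed.

(** * Lower bound for cyclotomic numbers *)

Definition coset_ind a x : R := (x / a \in C)%:R.

(** Subtracting the mean gives sum zero, as the norm bound requires. *)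
Definition centered_ind a x : R := coset_ind a x - t%:R / #|F|%:R.

Let natF : #|F|%:R = e%:R * t%:R + 1 :> R.
Proof. by rewrite cardF -natr1 natrM. Qed.

Let natF_gt0 : 0 < #|F|%:R :> R.
Proof. by rewrite cardF ltr0n. Qed.

Lemma sum_coset_ind a : a != 0 -> \sum_x coset_ind a x = t%:R.
Proof.
move=> a0; rewrite -(card_coset a0) -sum1_card natr_sum [RHS]big_mkcond /=.
by apply: eq_bigr => x _; rewrite /coset_ind inE; case: (_ \in C).
Qed.

Lemma sum_centered_ind a : a != 0 -> \sum_x centered_ind a x = 0.
Proof.
move=> a0; rewrite sumrB sum_coset_ind // sumr_const -[X in _ - X]mulr_natl.
by field; rewrite gt_eqF.
Qed.

Lemma sum_centered_ind_sqr a : a != 0 ->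
  \sum_x centered_ind a x ^+ 2 = t%:R - t%:R ^+ 2 / #|F|%:R.
Proof.
move=> a0; transitivity (\sum_x ((1 - 2 * (t%:R / #|F|%:R)) * coset_ind a x
                           + (t%:R / #|F|%:R) ^+ 2)).
  by apply: eq_bigr => x _; rewrite /centered_ind /coset_ind;
     case: (_ \in C) => /=; ring.
rewrite big_split /= -mulr_sumr sum_coset_ind // sumr_const.
by rewrite -[X in _ + X = _]mulr_natl; field; rewrite gt_eqF.
Qed.

(** Substituting [x * c] for [x] shows that every [c] in [C] contributes the same count; hence the
    factor [t]. *)
Lemma cyclotomic_count_sum a b (s : F) :
  t%:R * #|[set x | (x / a \in C) && ((x + s) / b \in C)]|%:R =
  \sum_x coset_ind a x * coset_sum (coset_ind b) s x.
Proof.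
under [RHS]eq_bigr => x _ do rewrite mulr_sumr.
rewrite exchange_big /= (eq_bigr (fun=>
  #|[set x | (x / a \in C) && ((x + s) / b \in C)]|%:R)).
  by rewrite sumr_const cardC mulr_natl.
move=> c cC; rewrite (reindex_inj (mulIf (C_neq0 cC))) -sum1_card natr_sum.
rewrite [RHS]big_mkcond; apply: eq_bigr => x _.
rewrite /coset_ind inE -mulrDl !(mulrAC _ c) !(memCMl _ cC).
by do 2!case: (_ \in C); rewrite /= ?mulr1 ?mulr0 ?mul0r.
Qed.

Lemma cyclotomic_count_bound a b (s : F) : a != 0 -> b != 0 -> s != 0 ->
  #|F|%:R - (e%:R - 1) ^+ 2 * Num.sqrt #|F|%:R - 2 * e%:R <=
  e%:R ^+ 2 * #|[set x | (x / a \in C) && ((x + s) / b \in C)]|%:R :> R.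
Proof.
move=> a0 b0 s0; set N := #|[set x | _]|.
have E1 : 1 < e%:R :> R by rewrite (ltr_nat _ 1 e).
have E0 : 0 < e%:R :> R by apply: lt_trans E1.
have T0 : 0 < t%:R :> R by rewrite ltr0n.
set u := centered_ind; set E : R := e%:R; set T : R := t%:R.
set q : R := #|F|%:R; set sq := Num.sqrt q.
have sq2 : sq ^+ 2 = q by rewrite sqr_sqrtr // ltW.
have sq1 : 1 <= sq.
  rewrite -[X in X <= _]sqrtr1 ler_wsqrtr // /q natF -/E -/T.
  by have := mulr_gt0 E0 T0; rewrite -/E -/T; lra.
have sq0 : 0 < sq by apply: lt_le_trans sq1.
have q0 : q != 0 by rewrite gt_eqF.
pose w := T - T ^+ 2 / q.
have normu z : z != 0 -> \sum_x u z x ^+ 2 = w by exact: sum_centered_ind_sqr.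
pose A x := coset_sum (u b) s x + u b x / E.
pose K := (E - 1) * sq / E.
have K0 : 0 < K by rewrite divr_gt0 // mulr_gt0 // subr_gt0.
have normA : \sum_x A x ^+ 2 <= K ^+ 2 * w.
  have := coset_sum_norm s0 (sum_centered_ind b0).
  rewrite -/u normu // natrM -natF -/q -/E -/(A) => normA.
  rewrite -(ler_pM2l (exprn_gt0 2 E0)) -/E; apply: le_trans normA _.
  rewrite le_eqVlt; apply/orP; left; apply/eqP.
  by rewrite /K -sq2; field; rewrite gt_eqF.
pose I := \sum_x u a x * A x; pose J := \sum_x u a x * u b x.
(* Cauchy-Schwarz for [u a] and [A], in the form of a nonnegative square. *)
have ge_I : - (K * w) <= I.
  have : 0 <= \sum_x (K * u a x + A x) ^+ 2.
    by apply: sumr_ge0 => x _; apply: sqr_ge0.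
  have -> : \sum_x (K * u a x + A x) ^+ 2 =
    \sum_x (K ^+ 2 * u a x ^+ 2 + 2 * K * (u a x * A x) + A x ^+ 2).
    by apply: eq_bigr => x _; ring.
  rewrite !big_split /= -!mulr_sumr normu // -/I => ge0.
  have : 0 <= (2 * K) * (I + K * w) by lra.
  have K2 : 0 < 2 * K by lra.
  by rewrite (pmulr_rge0 _ K2); lra.
have le_J : J <= w.
  have : 0 <= \sum_x (u a x - u b x) ^+ 2.
    by apply: sumr_ge0 => x _; apply: sqr_ge0.
  have -> : \sum_x (u a x - u b x) ^+ 2 =
    \sum_x (u a x ^+ 2 + u b x ^+ 2 + (- 2) * (u a x * u b x)).
    by apply: eq_bigr => x _; ring.
  by rewrite !big_split /= -!mulr_sumr !normu // -/J; lra.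
have sumA : \sum_x coset_sum (u b) s x = 0.
  rewrite exchange_big big1 //= => c _.
  by rewrite sum_shift sum_centered_ind.
(* Split both indicators into centred part and mean [T / q]. The means produce the main term
   [T ^ 3 / q], and the mixed terms vanish. *)
have count : T * N%:R = I - J / E + T ^+ 3 / q.
  rewrite cyclotomic_count_sum.
  transitivity (\sum_x (u a x * A x - u a x * u b x / E +
     T / q * coset_sum (u b) s x + T * (T / q) * coset_ind a x)).
    apply: eq_bigr => x _.
    have -> : coset_sum (coset_ind b) s x = coset_sum (u b) s x + T * (T / q).
      rewrite /coset_sum sumrB sumr_const cardC -[X in _ - X]mulr_natl.
      by rewrite -/T -/q; ring.
    by rewrite /A /u /centered_ind -/T -/q; field; rewrite q0 gt_eqF.
  rewrite !big_split /= sumrN -!mulr_sumr -mulr_suml sumA sum_coset_ind //.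
  by rewrite -/I -/J -/T; field; rewrite q0 gt_eqF.
have geN : T ^+ 3 / q - K * w - w / E <= T * N%:R.
  have : J / E <= w / E by rewrite ler_pM2r // invr_gt0.
  by rewrite count; lra.
rewrite -(ler_pM2l T0) -/T.
have -> : T * (E ^+ 2 * N%:R) = E ^+ 2 * (T * N%:R) by ring.
apply: le_trans (ler_wpM2l (exprn_ge0 2 (ltW E0)) geN); rewrite -/E.
have ET : T = (sq ^+ 2 - 1) / E.
  by rewrite sq2 /q natF -/E -/T; field; rewrite gt_eqF.
rewrite -subr_ge0.
(* The slack left after eliminating [T] by [E * T = q - 1]; it is nonnegative because [sq >= 1]. *)
have -> : E ^+ 2 * (T ^+ 3 / q - K * w - w / E) -
   T * (q - (E - 1) ^+ 2 * sq - 2 * E) = T * ((E - 1) * (1 - sq^-1)).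
  by rewrite /w /K -sq2 ET; field; rewrite !gt_eqF.
apply: mulr_ge0; first exact: ltW.
by apply: mulr_ge0; rewrite subr_ge0; [exact: ltW | rewrite invf_le1].
Qed.

End CosetSums.

(** * Greedy construction of the base blocks *)

Section BaseBlocks.

Variables (F : finFieldType) (k r t : nat) (w : F).
Hypothesis k_ge3 : (3 <= k)%N.
Hypothesis t_odd : odd t.
Hypothesis w_expk : w ^+ k = -1.
(* The bound is [heffter_n k r.+1]: at most [r] base blocks are already chosen
   when the next one is. *)
Hypothesis many : forall i j (s : F), s != 0 ->
  ((2 * r + 1) * (k - 2) + r <
    #|[set x | (x ^+ t == w ^+ i) && ((x + s) ^+ t == w ^+ j)]|)%N.

Implicit Types (b c : seq F) (i j m : nat).

(** A list rather than a set: its order is the one that will witness simplicity, and its index [i]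
    records the coset. *)
Definition base_block b :=
  [/\ size b = k, forall i, (i < k)%N -> b`_i ^+ t = w ^+ i,
      foldl +%R 0 b = 0 & uniq (partial_sums b)].

(* The ratios [b`_j / b`_i] and [c`_j / c`_i] differ. *)
Definition ratio_disjoint b c m :=
  forall i j, (i < j < m)%N -> b`_j * c`_i != c`_j * b`_i.

Let w_neq0 : w != 0.
Proof.
apply: contra_eqN w_expk => /eqP ->.
by rewrite expr0n gtn_eqF ?(ltn_trans _ k_ge3) // eq_sym oppr_eq0 oner_eq0.
Qed.

Let class_neq0 (x : F) i : x ^+ t = w ^+ i -> x != 0.
Proof.
move=> xw; have : x ^+ t != 0 by rewrite xw expf_neq0.
by rewrite expf_eq0 odd_gt0.
Qed.

Lemma exists_notin_seq (A : {set F}) (s : seq F) :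
  (size s < #|A|)%N -> exists2 x, x \in A & x \notin s.
Proof.
move=> lt_sA; apply/exists_inP; apply: contraTT lt_sA.
rewrite negb_exists_in -leqNgt => /forall_inP sA.
apply: leq_trans (card_size s); apply/subset_leq_card/subsetP => x xA.
by have := sA x xA; rewrite negbK.
Qed.

(** The leading [0] among the partial sums keeps the value [0] free for the last partial sum of the
    full block and makes the sum of a nonempty prefix nonzero. *)
Lemma base_block_prefix (L : seq (seq F)) m :
  (size L <= r)%N -> {in L, forall c, base_block c} -> (m <= k - 2)%N ->
  exists b, [/\ size b = m, forall i, (i < m)%N -> b`_i ^+ t = w ^+ i,
    uniq (0 :: partial_sums b) & {in L, forall c, ratio_disjoint b c m}].
Proof.
move=> szL baseL; elim: m => [|m IHm] lt_mk.
  by exists [::]; split => // c _ i j; rewrite ltn0 andbF.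
have [b [szb classb uniqb disjb]] := IHm (ltnW lt_mk).
pose s := foldl +%R 0 b.
(* The first family would repeat a partial sum, the second a ratio of an earlier block. *)
pose bad := [seq y - s | y <- 0 :: partial_sums b] ++
            [seq c`_m * b`_i / c`_i | c <- L, i <- iota 0 m].
have lt_bad : (size bad < #|[set x | x ^+ t == w ^+ m]|)%N.
  (* Only the size of a single coset matters here, so any nonzero shift serves; [1] is taken. *)
  apply: leq_ltn_trans (leq_trans (many m m (oner_neq0 F)) _).
    rewrite size_cat size_map size_allpairs size_iota /= size_scanl szb.
    by nia.
  by apply/subset_leq_card/subsetP => x; rewrite !inE => /andP[].
have [x] := exists_notin_seq lt_bad; rewrite inE => /eqP classx.
rewrite mem_cat negb_or => /andP[badP badR].
exists (rcons b x); split.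
- by rewrite size_rcons szb.
- move=> i; rewrite ltnS nth_rcons szb; case: ltngtP => // [|->] //.
  by move=> /classb.
- rewrite /partial_sums scanl_rcons foldl_rcons -/s -rcons_cons rcons_uniq.
  rewrite uniqb andbT; apply: contra badP => sxP.
  by apply/mapP; exists (s + x) => //; rewrite addrC addKr.
move=> c cL i j /andP[lt_ij]; rewrite ltnS !nth_rcons szb.
case: (ltngtP j m) => // [lt_jm _ | eq_jm _].
  by rewrite (ltn_trans lt_ij lt_jm); apply: disjb => //; apply/andP.
rewrite -{1}eq_jm lt_ij eq_jm; apply: contra badR => /eqP eq_x.
apply/allpairsP; exists (c, i); split=> //=; first by rewrite mem_iota -eq_jm.
have [_ classc _ _] := baseL c cL.
have ci0 : c`_i != 0 by apply/class_neq0/classc; lia.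
by rewrite -eq_x mulfK.
Qed.

(** The last two entries are chosen together: [x], then [y = - (s + x)] to reach sum zero. *)
Lemma base_block_extend (L : seq (seq F)) :
  (size L <= r)%N -> {in L, forall c, base_block c} ->
  exists2 b, base_block b & {in L, forall c, ratio_disjoint b c k}.
Proof.
move=> szL baseL.
have [b [szb classb uniqb disjb]] := base_block_prefix szL baseL (leqnn _).
set m := (k - 2)%N in szb classb disjb.
have km : k = m.+2 by rewrite /m; lia.
pose s := foldl +%R 0 b.
have s0 : s != 0.
  rewrite /s; move: uniqb szb; case/lastP: b {classb disjb s} => [|b x].
    by move=> _ /=; rewrite /m; lia.
  rewrite /partial_sums scanl_rcons -rcons_cons rcons_uniq => /andP[+ _] _.
  by rewrite inE negb_or => /andP[].
(* In order: repeated partial sums, ratios of [x] to the prefix, ratios of [y] to the prefix, and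
   the ratio of [y] to [x]. With at most [r] blocks in [L] this is at most
   [(k-2) + r(k-2) + r(k-2) + r] values, the bound in [many]. *)
pose bad := [seq y - s | y <- partial_sums b] ++
  [seq c`_m * b`_i / c`_i | c <- L, i <- iota 0 m] ++
  [seq - s - c`_m.+1 * b`_i / c`_i | c <- L, i <- iota 0 m] ++
  [seq - s * c`_m / (c`_m.+1 + c`_m) | c <- L].
(* The exponent [k + m.+1] stands for the negative of class [m.+1], since [w ^ k = -1]. *)
have lt_bad : (size bad < #|[set x | (x ^+ t == w ^+ m) &&
                                     ((x + s) ^+ t == w ^+ (k + m.+1))]|)%N.
  apply: leq_ltn_trans (many _ _ s0).
  rewrite !size_cat !size_map !size_allpairs size_iota /= size_scanl szb -/m.
  by nia.
have [x] := exists_notin_seq lt_bad; rewrite inE => /andP[/eqP classx /eqP classxs].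
rewrite !mem_cat !negb_or => /and4P[badP badx bady badxy].
pose y := - (s + x).
have classy : y ^+ t = w ^+ m.+1.
  by rewrite /y exprNn -signr_odd t_odd addrC classxs exprD w_expk; ring.
have nthb i : (i < m)%N -> (b ++ [:: x; y])`_i = b`_i.
  by move=> im; rewrite nth_cat szb im.
have nthx : (b ++ [:: x; y])`_m = x by rewrite nth_cat szb ltnn subnn.
have nthy : (b ++ [:: x; y])`_m.+1 = y.
  by rewrite nth_cat szb ltnNge leqnSn /= subSnn.
exists (b ++ [:: x; y]).
  split.
  - by rewrite size_cat szb /= addn2 km.
  - move=> i; rewrite km ltnS leq_eqVlt => /predU1P[->|]; first by rewrite nthy.
    rewrite ltnS leq_eqVlt => /predU1P[->|im]; first by rewrite nthx.
    by rewrite nthb // classb.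
  - by rewrite foldl_cat /= -/s /y subrr.
  rewrite /partial_sums scanl_cat /= -/s /y subrr.
  move: uniqb; rewrite /= => /andP[zP uP]; rewrite cat_uniq uP /= orbF negb_or.
  rewrite inE andbT zP andbT; apply/andP; split.
    apply: contra badP => sxP; apply/mapP; exists (s + x) => //.
    by rewrite addrC addKr.
  (* The partial sum [s + x = - y] differs from the final [0] without any further exclusion. *)
  by rewrite -oppr_eq0 -/y (class_neq0 classy).
move=> c cL i j; have [_ classc _ _] := baseL c cL.
have c0 l : (l < k)%N -> c`_l != 0 by move=> lk; apply/class_neq0/classc.
move=> /andP[lt_ij]; rewrite km ltnS leq_eqVlt => /predU1P[eq_j|].
  rewrite eq_j nthy; move: lt_ij; rewrite eq_j ltnS leq_eqVlt.
  case/predU1P => [->|im].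
    rewrite nthx; apply: contra badxy => /eqP eq_xy.
    have sumx : x * (c`_m.+1 + c`_m) = - s * c`_m.
      by rewrite mulrDr [x * _]mulrC -eq_xy /y; ring.
    apply/mapP; exists c => //; rewrite -sumx mulfK //.
    (* The denominator cannot vanish: otherwise [s * c_m] would be zero, with both factors
       nonzero. *)
    apply: contra_eqN sumx => /eqP ->; rewrite mulr0 eq_sym mulf_neq0 ?oppr_eq0 //.
    by apply: c0; rewrite km.
  rewrite nthb //; apply: contra bady => /eqP eq_y.
  apply/allpairsP; exists (c, i); split=> //=; first by rewrite mem_iota.
  have ci0 : c`_i != 0 by apply: c0; lia.
  by rewrite -eq_y mulfK // /y; ring.
rewrite ltnS leq_eqVlt => /predU1P[eq_j|jm].
  rewrite eq_j nthx nthb; last by rewrite -eq_j.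
  apply: contra badx => /eqP eq_x.
  apply/allpairsP; exists (c, i); split=> //=; first by rewrite mem_iota -eq_j.
  have ci0 : c`_i != 0 by apply: c0; lia.
  by rewrite -eq_x mulfK.
rewrite !nthb //; last exact: ltn_trans jm.
by apply: disjb => //; apply/andP.
Qed.

Lemma base_blocks_exist : exists f : nat -> seq F,
  (forall i, (i < r.+1)%N -> base_block (f i)) /\
  (forall i j, (i < j < r.+1)%N -> ratio_disjoint (f j) (f i) k).
Proof.
suff H m : (m <= r.+1)%N -> exists f : nat -> seq F,
  (forall i, (i < m)%N -> base_block (f i)) /\
  (forall i j, (i < j < m)%N -> ratio_disjoint (f j) (f i) k) by exact: H.
elim: m => [|m IHm] le_mr.
  by exists (fun=> [::]); split => // i j; rewrite ltn0 andbF.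
have [f [basef disjf]] := IHm (ltnW le_mr).
have [||b baseb disjb] := @base_block_extend [seq f i | i <- iota 0 m].
- by rewrite size_map size_iota.
- by move=> _ /mapP[i + ->]; rewrite mem_iota => /basef.
exists (fun i => if i == m then b else f i); split.
  by move=> i; rewrite ltnS; case: ltngtP => // im _; apply: basef.
move=> i j /andP[lt_ij]; rewrite ltnS => le_jm.
rewrite (ltn_eqF (leq_trans lt_ij le_jm)).
case: (ltngtP j m) le_jm => // [jm _|eq_jm _]; first by apply: disjf; apply/andP.
by apply: disjb; apply/mapP; exists i => //; rewrite mem_iota -eq_jm.
Qed.

End BaseBlocks.

(** * The Heffter space generated by base blocks *)

Lemma prim_root_half_exp (D : idomainType) (k : nat) (w : D) :
  (2 * k).-primitive_root w -> w ^+ k = -1.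
Proof.
move=> prim_w; have k_gt0 := prim_order_gt0 prim_w.
have /eqP : (w ^+ k) ^+ 2 = 1 by rewrite -exprM mulnC prim_expr_order.
rewrite -[X in _ == X](expr1n _ 2) eqf_sqr => /orP[|/eqP //].
by rewrite -(prim_order_dvd prim_w) => /dvdn_leq; lia.
Qed.

Lemma foldl_addr (G : nmodType) (s : seq G) : foldl +%R 0 s = \sum_(x <- s) x.
Proof.
suff gen z : foldl +%R z s = z + \sum_(x <- s) x by rewrite gen add0r.
elim: s z => [|x s IHs] z /=; first by rewrite big_nil addr0.
by rewrite IHs big_cons addrA.
Qed.

Lemma partial_sums_scale (G : finNzRingType) (c : G) (s : seq G) :
  partial_sums [seq x * c | x <- s] = [seq x * c | x <- partial_sums s].
Proof.
rewrite /partial_sums -[X in scanl _ X _ = _](mul0r c).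
by elim: s 0 => //= x s IHs y; rewrite -mulrDl IHs.
Qed.

Section Development.

Variables (F : finFieldType) (k r t : nat) (w : F) (f : nat -> seq F).
Hypothesis k_ge2 : (2 <= k)%N.
Hypothesis t_odd : odd t.
Hypothesis prim_w : (2 * k).-primitive_root w.
Hypothesis cardF : #|F| = (2 * k * t).+1.
Hypothesis class : forall x : F, x != 0 -> exists2 i, (i < 2 * k)%N & x ^+ t = w ^+ i.
Hypothesis base_f : forall s, (s < r)%N -> base_block k t w (f s).
Hypothesis disj_f : forall s s', (s < s' < r)%N -> ratio_disjoint (f s') (f s) k.

Definition kernel : {set F} := [set c | c ^+ t == 1].

(** Cosets of [kernel] are encoded as fibres of the [t]-th power map, which avoids coset
    representatives. *)
Definition points : {set F} := [set x | [exists i : 'I_k, x ^+ t == w ^+ i]].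

Definition dev_block (s : nat) (c : F) : {set F} := [set x * c | x in f s].

Definition parallel_class (s : nat) : {set {set F}} :=
  [set dev_block s c | c in kernel].

Definition dev_blocks : {set {set F}} := \bigcup_(s < r) parallel_class s.

Let w_neq0 : w != 0.
Proof. by rewrite (prim_root_eq0 prim_w) muln_eq0 negb_or /= -lt0n ltnW. Qed.

Let class_neq0 (x : F) i : x ^+ t = w ^+ i -> x != 0.
Proof.
move=> xw; have : x ^+ t != 0 by rewrite xw expf_neq0.
by rewrite expf_eq0 odd_gt0.
Qed.

Let class_inj i j : (i < 2 * k)%N -> (j < 2 * k)%N -> w ^+ i = w ^+ j -> i = j.
Proof.
by move=> ik jk /eqP; rewrite (eq_prim_root_expr prim_w) !modn_small // => /eqP.
Qed.

Let kernel_neq0 c : c \in kernel -> c != 0.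
Proof. by rewrite inE => /eqP cw; apply: (@class_neq0 c 0); rewrite cw. Qed.

Let base_class s i : (s < r)%N -> (i < k)%N -> (f s)`_i ^+ t = w ^+ i.
Proof. by move=> /base_f[_ classf _ _]; apply: classf. Qed.

Let base_neq0 s i : (s < r)%N -> (i < k)%N -> (f s)`_i != 0.
Proof. by move=> sr ik; apply/class_neq0/(base_class sr ik). Qed.

Let base_inj s i j : (s < r)%N -> (i < k)%N -> (j < k)%N ->
  (f s)`_i = (f s)`_j -> i = j.
Proof.
move=> sr ik jk fij; apply: class_inj; [lia|lia|].
by rewrite -(base_class sr ik) fij base_class.
Qed.

Lemma base_uniq s : (s < r)%N -> uniq (f s).
Proof.
move=> sr; have [szf _ _ _] := base_f sr.
by apply/(uniqP 0) => i j; rewrite !inE szf; apply: base_inj.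
Qed.

Lemma pointsP x : reflect (exists2 i, (i < k)%N & x ^+ t = w ^+ i) (x \in points).
Proof.
rewrite inE; apply: (iffP existsP) => [[i /eqP xi]|[i ik xi]].
  by exists i.
by exists (Ordinal ik); rewrite xi.
Qed.

Lemma dev_blockP s c x : (s < r)%N ->
  reflect (exists2 i, (i < k)%N & x = (f s)`_i * c) (x \in dev_block s c).
Proof.
move=> sr; have [szf _ _ _] := base_f sr.
apply: (iffP imsetP) => [[y /(nthP 0)[i]]|[i ik ->]].
  by rewrite szf => ik <- ->; exists i.
by exists (f s)`_i => //; rewrite mem_nth // szf.
Qed.

Lemma dev_block_class s c i : (s < r)%N -> (i < k)%N -> c \in kernel ->
  ((f s)`_i * c) ^+ t = w ^+ i.
Proof.
by move=> sr ik; rewrite inE exprMn => /eqP ->; rewrite mulr1 base_class.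
Qed.

(** A developed block is a transversal of the first [k] classes, so the class of a point fixes its
    index. *)
Lemma dev_block_point s c x i : (s < r)%N -> c \in kernel -> (i < k)%N ->
  x \in dev_block s c -> x ^+ t = w ^+ i -> x = (f s)`_i * c.
Proof.
move=> sr cK ik /(dev_blockP _ _ sr)[j jk ->]; rewrite dev_block_class // => wij.
by rewrite (@class_inj j i) //; lia.
Qed.

Lemma dev_block_sub s c : (s < r)%N -> c \in kernel -> dev_block s c \subset points.
Proof.
move=> sr cK; apply/subsetP => x /(dev_blockP _ _ sr)[i ik ->].
by apply/pointsP; exists i => //; apply: dev_block_class.
Qed.

Lemma card_dev_block s c : (s < r)%N -> c \in kernel -> #|dev_block s c| = k.
Proof.
move=> sr cK; rewrite card_imset; last exact/mulIf/kernel_neq0.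
by rewrite (card_uniqP (base_uniq sr)); have [] := base_f sr.
Qed.

(** The quotient [y / x] is a ratio of both base blocks at the same two indices, which forces
    [s = s']; then [x] determines the multiplier. *)
Lemma dev_block_common_pair s s' c d x y : (s < r)%N -> (s' < r)%N ->
  c \in kernel -> d \in kernel -> x != y ->
  x \in dev_block s c -> y \in dev_block s c ->
  x \in dev_block s' d -> y \in dev_block s' d -> s = s' /\ c = d.
Proof.
move=> sr s'r cK dK neq_xy /(dev_blockP _ _ sr)[i ik xE] /(dev_blockP _ _ sr)[j jk yE].
have classx : x ^+ t = w ^+ i by rewrite xE dev_block_class.
have classy : y ^+ t = w ^+ j by rewrite yE dev_block_class.
move=> /dev_block_point-/(_ _ s'r dK ik classx) xE'.
move=> /dev_block_point-/(_ _ s'r dK jk classy) yE'.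
have neq_ij : i != j by apply: contraNneq neq_xy => ij; rewrite xE yE ij.
have c0 := kernel_neq0 cK; have d0 := kernel_neq0 dK.
have ratio : (f s)`_j * (f s')`_i = (f s')`_j * (f s)`_i.
  apply: (mulIf (mulf_neq0 c0 d0)); rewrite mulrACA -yE -xE' yE' xE.
  by rewrite mulrACA [c * d]mulrC.
have ratio' : (f s)`_i * (f s')`_j = (f s')`_i * (f s)`_j.
  by rewrite mulrC -ratio mulrC.
have ss' : s = s'.
  (* Four cases, because [disj_f] covers only increasing pairs of blocks and of indices. *)
  case: (ltngtP s s') => // lt_ss'; case: (ltngtP i j) neq_ij => // lt_ij _.
  - have /disj_f/(_ i j) : (s < s' < r)%N by rewrite lt_ss'.
    by rewrite lt_ij jk ratio eqxx => /(_ isT).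
  - have /disj_f/(_ j i) : (s < s' < r)%N by rewrite lt_ss'.
    by rewrite lt_ij ik ratio' eqxx => /(_ isT).
  - have /disj_f/(_ i j) : (s' < s < r)%N by rewrite lt_ss'.
    by rewrite lt_ij jk ratio eqxx => /(_ isT).
  have /disj_f/(_ j i) : (s' < s < r)%N by rewrite lt_ss'.
  by rewrite lt_ij ik ratio' eqxx => /(_ isT).
split=> //; apply: (mulfI (base_neq0 sr ik)).
by rewrite -xE xE' ss'.
Qed.

Lemma dev_block_inj s s' c d : (s < r)%N -> (s' < r)%N ->
  c \in kernel -> d \in kernel ->
  dev_block s c = dev_block s' d -> s = s' /\ c = d.
Proof.
move=> sr s'r cK dK eq_sd.
have k0 : (0 < k)%N by exact: ltnW.
have m0 : (f s)`_0 * c \in dev_block s c by apply/dev_blockP => //; exists 0%N.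
have m1 : (f s)`_1 * c \in dev_block s c by apply/dev_blockP => //; exists 1%N.
apply: (dev_block_common_pair sr s'r cK dK _ m0 m1); rewrite -?eq_sd //.
by apply/eqP => /(mulIf (kernel_neq0 cK))/base_inj-/(_ sr k0 k_ge2).
Qed.

Lemma dev_blocksP A :
  reflect (exists s c, [/\ (s < r)%N, c \in kernel & A = dev_block s c])
          (A \in dev_blocks).
Proof.
apply: (iffP bigcupP) => [[s _ /imsetP[c cK ->]]|[s [c [sr cK ->]]]].
  by exists s, c.
by exists (Ordinal sr) => //; apply: imset_f.
Qed.

(** The multiplier is the quotient of [x] by the base entry of the same class, hence a [t]-th root
    of unity. *)
Lemma dev_block_through x s : (s < r)%N -> x \in points ->
  exists2 c, c \in kernel & x \in dev_block s c.
Proof.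
move=> sr /pointsP[i ik xi]; have f0 := base_neq0 sr ik.
exists (x / (f s)`_i).
  rewrite inE exprMn exprVn xi base_class // mulfV //.
  by rewrite expf_neq0.
by apply/dev_blockP => //; exists i => //; rewrite mulrC divfK.
Qed.

Lemma half_set_points : half_set points.
Proof.
(* Negation shifts the class index by [k], exchanging the lower and upper halves of the [2 * k]
   classes. *)
have oppw (y : F) : (- y) ^+ t = w ^+ k * y ^+ t.
  by rewrite exprNn -signr_odd t_odd (prim_root_half_exp prim_w).
split.
  rewrite -setI_eq0; apply/eqP/setP => x; rewrite inE [RHS]inE.
  apply/negP => /andP[/pointsP[i ik xi] /imsetP[y /pointsP[j jk yj] xy]].
  have : w ^+ i = w ^+ (k + j) by rewrite -xi xy oppw yj exprD.
  by move/class_inj; lia.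
apply/setP => x; rewrite !inE; apply/idP/idP => [/orP[]|x0].
- by case/existsP=> i /eqP/class_neq0.
- by case/imsetP=> y /pointsP[i _ /class_neq0 y0] ->; rewrite oppr_eq0.
have [i i2k xi] := class x0; case: (ltnP i k) => ik.
  by apply/orP; left; apply/existsP; exists (Ordinal ik); rewrite xi.
apply/orP; right; apply/imsetP; exists (- x); rewrite ?opprK //.
apply/pointsP; exists (i - k)%N; first by lia.
by rewrite oppw xi -{1}(subnK ik) exprD (prim_root_half_exp prim_w); ring.
Qed.

Lemma card_points : #|points| = (k * t)%N.
Proof.
have [disj union] := half_set_points.
have := cardsC1 (0 : F); rewrite -union cardsU cardF /=.
move: disj; rewrite -setI_eq0 => /eqP ->; rewrite cards0 subn0.
rewrite card_imset; last exact: oppr_inj.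
by rewrite addnn -mul2n -mulnA => /eqP; rewrite eqn_mul2l => /eqP.
Qed.

(** Each of the [r] parallel classes has exactly one block through [x], the one with multiplier
    [c s]. *)
Lemma card_blocks_through x : x \in points ->
  #|[set A in dev_blocks | x \in A]| = r.
Proof.
move=> xV; have /pointsP[i ik xi] := xV.
pose c s := x / (f s)`_i.
have cP s d : (s < r)%N -> d \in kernel -> x \in dev_block s d -> d = c s.
  move=> sr dK xs; rewrite /c (dev_block_point sr dK ik xs xi) mulrC mulKf //.
  exact: base_neq0.
have cK s : (s < r)%N -> c s \in kernel /\ x \in dev_block s (c s).
  move=> sr; have [d dK xd] := dev_block_through sr xV.
  by rewrite -(cP s d).
have -> : [set A in dev_blocks | x \in A] = [set dev_block s (c s) | s : 'I_r].
  apply/setP => A; rewrite inE; apply/andP/imsetP => [[]|[s _ ->]].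
    case/dev_blocksP => s [d [sr dK ->]] xd; exists (Ordinal sr) => //=.
    by rewrite (cP s d).
  have [csK xs] := cK s (ltn_ord s).
  by split=> //; apply/dev_blocksP; exists s, (c s).
rewrite card_imset ?card_ord // => s s' eq_ss'; apply/val_inj.
by have [] := dev_block_inj (ltn_ord s) (ltn_ord s')
   (cK s (ltn_ord s)).1 (cK s' (ltn_ord s')).1 eq_ss'.
Qed.

Lemma dev_configuration :
  configuration points dev_blocks (k * t) r #|dev_blocks| k.
Proof.
split=> //; first exact: card_points.
- move=> A /dev_blocksP[s [c [sr cK ->]]].
  by rewrite dev_block_sub // card_dev_block.
- move=> x y _ _ neq_xy; apply/card_le1_eqP => A B.
  rewrite !inE => /and3P[/dev_blocksP[s [c [sr cK ->]]] xs ys].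
  case/and3P => /dev_blocksP[s' [d [s'r dK ->]]] xs' ys'.
  by have [-> ->] := dev_block_common_pair sr s'r cK dK neq_xy xs ys xs' ys'.
by move=> x xV; apply: card_blocks_through.
Qed.

Lemma parallel_class_partition s : (s < r)%N ->
  partition (parallel_class s) points.
Proof.
move=> sr; apply/and3P; split.
- rewrite eqEsubset; apply/andP; split.
    by apply/bigcupsP => _ /imsetP[c cK ->]; apply: dev_block_sub.
  apply/subsetP => x /(dev_block_through sr)[c cK xc].
  by apply/bigcupP; exists (dev_block s c) => //; apply: imset_f.
- apply/trivIsetP => _ _ /imsetP[c cK ->] /imsetP[d dK ->].
  apply: contraNT; rewrite -setI_eq0 => /set0Pn[x /setIP[xc xd]].
  have /(dev_blockP _ _ sr)[i ik xE] := xc.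
  have xi : x ^+ t = w ^+ i by rewrite xE dev_block_class.
  have := dev_block_point sr dK ik xd xi; rewrite xE.
  by move/(mulfI (base_neq0 sr ik)) ->.
apply/imsetP => -[c cK /(congr1 (fun A : {set F} => #|A|))].
by rewrite cards0 card_dev_block //; lia.
Qed.

Lemma dev_resolvable : resolvable points dev_blocks r.
Proof.
have k1 : 1 \in kernel by rewrite inE expr1n.
(* A member of each class, used to see that the classes are nonempty and pairwise distinct. *)
have mem1 s : dev_block s 1 \in parallel_class s by apply: imset_f.
exists [set parallel_class s | s : 'I_r]; split.
- apply/and3P; split.
  + by rewrite cover_imset.
  + apply/trivIsetP => _ _ /imsetP[s _ ->] /imsetP[s' _ ->].
    apply: contraNT; rewrite -setI_eq0 => /set0Pn[A /setIP[]].
    move=> /imsetP[c cK ->] /imsetP[d dK].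
    by case/(dev_block_inj (ltn_ord s) (ltn_ord s') cK dK) => ->.
  apply/imsetP => -[s _ s0]; have := mem1 s.
  by rewrite -s0 inE.
- rewrite card_imset ?card_ord // => s s' eq_ss'.
  have := mem1 s; rewrite eq_ss' => /imsetP[d dK].
  by case/(dev_block_inj (ltn_ord s) (ltn_ord s') k1 dK) => /val_inj.
by move=> _ /imsetP[s _ ->]; apply: parallel_class_partition.
Qed.

Lemma dev_blocks_zero_sum : {in dev_blocks, forall A, zero_sum A}.
Proof.
move=> _ /dev_blocksP[s [c [sr cK ->]]]; rewrite /zero_sum big_imset /=; last first.
  by move=> x y _ _ /(mulIf (kernel_neq0 cK)).
rewrite -mulr_suml -big_uniq ?base_uniq // -foldl_addr.
by have [_ _ -> _] := base_f sr; rewrite mul0r.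
Qed.

Lemma dev_blocks_simple : simple_blocks dev_blocks.
Proof.
move=> _ /dev_blocksP[s [c [sr cK ->]]]; have cI := mulIf (kernel_neq0 cK).
exists [seq x * c | x <- f s]; split; last first.
  by rewrite partial_sums_scale map_inj_uniq //; have [] := base_f sr.
apply: uniq_perm; rewrite ?enum_uniq ?map_inj_uniq ?base_uniq // => x.
by rewrite mem_enum; apply/mapP/imsetP.
Qed.

Lemma dev_heffter_space : heffter_space points dev_blocks (k * t) k r.
Proof.
split; first by exists #|dev_blocks|; apply: dev_configuration.
- exact: dev_resolvable.
- exact: half_set_points.
exact: dev_blocks_zero_sum.
Qed.

End Development.

(** * Primitive elements, the threshold Q(k, r), and the conclusion *)

Lemma finField_prim_root (F : finFieldType) :
  exists g : F, #|F|.-1.-primitive_root g.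
Proof.
have F_gt1 := finNzRing_gt1 F.
have [||||g _ prim_g] := hasP (@has_prim_root F #|F|.-1 (enum (predC1 (0 : F))) _ _ _ _).
- by rewrite -subn1 subn_gt0.
- apply/allP => x; rewrite mem_enum inE => x0; apply/unity_rootP.
  apply: (mulIf x0); rewrite -exprSr prednK; last exact: ltnW.
  by rewrite expf_card mul1r.
- exact: enum_uniq.
- by rewrite -cardE cardC1.
by exists g.
Qed.

(** With [s = sqrt q], the claim is the quadratic inequality [s ^ 2 - A * s > 4k(kn + 1)], and
    [Q(k, r)] is the square of the larger root. *)
Lemma heffter_Q_bound (R : realType) (k r : nat) (q : R) : (0 < k)%N ->
  heffter_Q R k r < q ->
  (2 * k)%:R ^+ 2 * (heffter_n k r)%:~R <
  q - ((2 * k)%:R - 1) ^+ 2 * Num.sqrt q - 2 * (2 * k)%:R.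
Proof.
move=> k0; rewrite /heffter_Q natrM.
set K : R := k%:R; set n : R := (heffter_n k r)%:~R.
set A : R := (2 * K - 1) ^+ 2; set D : R := (2 * K - 1) ^+ 4 + _ => hQ.
have A0 : 0 <= A by exact: sqr_ge0.
have D0 : 0 <= Num.sqrt D by exact: sqrtr_ge0.
have q0 : 0 <= q.
  by apply: le_trans (ltW hQ); rewrite mulr_ge0 ?sqr_ge0 // invr_ge0 ler0n.
set s : R := Num.sqrt q; have s0 : 0 <= s by exact: sqrtr_ge0.
have s2 : s ^+ 2 = q by rewrite sqr_sqrtr.
have lt_s : A + Num.sqrt D < 2 * s.
  have AD0 : 0 <= A + Num.sqrt D by rewrite addr_ge0.
  have S0 : 0 <= 2 * s by rewrite mulr_ge0 // ler0n.
  rewrite -(ltr_pXn2r (n:=2)) ?nnegrE //.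
  by rewrite exprMn s2; move: hQ; lra.
have ltD : D < (2 * s - A) ^+ 2.
  (* A negative [D], on which [Num.sqrt] defaults to [0], lies below every square. *)
  case: (lerP 0 D) => [D_ge0|D_lt0]; last exact: lt_le_trans (sqr_ge0 _).
  have sA : 0 <= 2 * s - A by lra.
  rewrite -{1}(sqr_sqrtr D_ge0) ltr_pXn2r ?nnegrE // -subr_gt0.
  by rewrite -subr_gt0 in lt_s; lra.
have DA : D = A ^+ 2 + 16 * K * (K * n + 1) by rewrite /D /A; ring.
by move: ltD; rewrite DA -s2 -/A; lra.
Qed.

Theorem theorem3p1 (R : realType) (k r : nat) (hk : (3 <= k)%N)
    (q : nat) (hq : prime_power q)
    (hmod : (q = 2 * k + 1 %[mod 4 * k])%N)
    (hQ : heffter_Q R k r < q%:R) :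
  exists (G : finZmodType) (V : {set G}) (B : {set {set G}}),
    heffter_space V B ((q - 1) %/ 2)%N k r /\ simple_blocks B.
Proof.
have [p [m [p_pr m_gt0 qE]]] := hq.
have [F _ cardF] := pPrimePowerField p_pr m_gt0; rewrite -qE in cardF.
have [t t_odd qt] : exists2 t, odd t & q = (2 * k * t).+1.
  (* If [q = 4k u + 2k + 1], then [q - 1 = 2k (2u + 1)]. *)
  exists (2 * (q %/ (4 * k)) + 1)%N; first by rewrite addn1 /= mul2n odd_double.
  rewrite {1}(divn_eq q (4 * k)) hmod modn_small; last by lia.
  by lia.
have t_gt0 := odd_gt0 t_odd.
have cardFt : #|F| = (2 * k * t).+1 by rewrite cardF.
have [g prim_g] := finField_prim_root F; rewrite cardFt /= in prim_g.
have prim_w : (2 * k).-primitive_root (g ^+ t).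
  have := dvdn_prim_root prim_g (dvdn_mulr t (dvdnn (2 * k))).
  by rewrite mulKn //; lia.
have prim_z : t.-primitive_root (g ^+ (2 * k)).
  by have := dvdn_prim_root prim_g (dvdn_mull (2 * k) (dvdnn t)); rewrite mulnK.
set w := g ^+ t in prim_w.
have class (x : F) : x != 0 -> exists2 i, (i < 2 * k)%N & x ^+ t = w ^+ i.
  move=> x0; have [|i xi] := @prim_rootP _ _ w prim_w (x ^+ t); last by exists i.
  rewrite -exprM mulnC; apply: (mulIf x0).
  by rewrite -exprSr -cardFt expf_card mul1r.
have g0 : g != 0.
  by rewrite (prim_root_eq0 prim_g) muln_eq0 negb_or; lia.
(* Translates the cosets of the counting bound into conditions on [t]-th powers; for [a = g ^ i] the
   condition is [x ^ t = w ^ i]. *)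
have divK (x a : F) : a != 0 -> (x / a \in kernel F t) = (x ^+ t == a ^+ t).
  move=> a0; rewrite inE exprMn exprVn -(inj_eq (mulIf (expf_neq0 t a0))).
  by rewrite divfK ?expf_neq0 // mul1r.
have cardK : #|kernel F t| = t.
  have -> : kernel F t = [set (g ^+ (2 * k)) ^+ i | i : 'I_t].
    apply/setP => x; rewrite inE; apply/eqP/imsetP => [xt|[i _ ->]].
      by have [i ->] := prim_rootP prim_z xt; exists i.
    by rewrite [LHS]exprAC (prim_expr_order prim_z) expr1n.
  rewrite card_imset ?card_ord // => i j /eqP.
  by rewrite (eq_prim_root_expr prim_z) !modn_small // => /eqP/val_inj.
have many i j (s : F) : s != 0 ->
    heffter_n k r < #|[set x | (x ^+ t == w ^+ i) && ((x + s) ^+ t == w ^+ j)]|%:Z.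
  move=> s0.
  have := @cyclotomic_count_bound R F (kernel F t) (2 * k) t _ _ _ _ cardK cardFt
    _ (g ^+ i) (g ^+ j) s (expf_neq0 _ g0) (expf_neq0 _ g0) s0.
  under eq_finset => x do rewrite !divK ?expf_neq0 // ![(g ^+ _) ^+ t]exprAC -/w.
  set N := #|_| => bound.
  rewrite -(ltr_int R) -(ltr_pM2l (x := (2 * k)%:R ^+ 2)).
    apply: lt_le_trans (bound _ _ _ _ _).
    - by rewrite cardF; apply: heffter_Q_bound => //; lia.
    - by rewrite inE expr1n.
    - by move=> x y; rewrite !inE exprMn => /eqP -> /eqP ->; rewrite mulr1.
    - by move=> x; rewrite !inE exprVn => /eqP ->; rewrite invr1.
    - by rewrite inE expr0n gtn_eqF // eq_sym oner_eq0.
    by lia.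
  by rewrite exprn_gt0 // ltr0n; lia.
have [f [base_f disj_f]] : exists f : nat -> seq F,
    (forall s, (s < r)%N -> base_block k t w (f s)) /\
    (forall s s', (s < s' < r)%N -> ratio_disjoint (f s') (f s) k).
  (* For [r = 0] no base block is required; the greedy construction produces [r.+1] of them. *)
  case: r {hQ} many => [_|r many].
    by exists (fun=> [::]); split=> // s s'; rewrite ltn0 andbF.
  apply: (base_blocks_exist hk t_odd (prim_root_half_exp prim_w)) => i j s s0.
  by have := many i j s s0; rewrite /heffter_n; set N := #|_|; move: N; lia.
have k_ge2 : (2 <= k)%N by lia.
exists F, (points k t w), (dev_blocks r t f); split.
  have -> : ((q - 1) %/ 2 = k * t)%N by rewrite qt subn1 -mulnA mulKn.
  exact: dev_heffter_space.
exact: (dev_blocks_simple k_ge2 t_odd prim_w).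
Qed.
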